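(* In the general setting (agents may misreport both positions and preferences), the Middle mechanism is group-strategyproof and has an approximation ratio of at most $2$.
   Context: Setting: a finite nonempty set $N$ of $n$ agents and two facilities $1,2$. Agent $i$ has a position $x_i\in[0,1]$ and an approval preference $t_i=(t_{i1},t_{i2})\in\{0,1\}^2$ ($t_{ij}=1$ iff $i$ approves facility $j$); every agent approves one of the two facilities or both. An instance is $I=(\mathbf{x},\mathbf{t})$ with $\mathbf{x}=(x_i)_{i\in N}$, $\mathbf{t}=(t_i)_{i\in N}$. If facility $j$ is located at $y\in[0,1]$ (a single facility is located), agent $i$ has utility $u_i(j,y|I)=t_{ij}(1-|x_i-y|)$; the social welfare is $W(j,y|I)=\sum_{i\in N}u_i(j,y|I)$ and $W^*(I)=\max_{(j,y)}W(j,y|I)$. A (deterministic) mechanism $M$ maps each reported instance $I$ to an outcome $M(I)=(j,y)\in\{1,2\}\times[0,1]$. Its approximation ratio is $\rho(M)=\sup_I W^*(I)/W(M(I)|I)$ over all instances. In the general setting agents may misreport positions and preferences. $M$ is group-strategyproof if no coalition of agents can simultaneously misreport such that the utility of every agent in the coalition strictly increases; that is, there are no instance $I$ of true data, nonempty coalition, and joint misreport of positions and preferences by the coalition leading to an instance $I'$, such that $u_i(M(I')|I)>u_i(M(I)|I)$ for every agent $i$ in the coalition. Middle mechanism: count the number $n_j$ of agents that approve each facility $j\in\{1,2\}$, and locate the most preferred facility (the one with the larger count) at $1/2$, breaking ties arbitrarily. The positions of the agents are not taken into account when deciding which facility to locate and where. *)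

(* Defs.v *)
From mathcomp Require Import all_boot all_order all_algebra.
From mathcomp Require Import all_classical all_reals all_analysis.

Set Implicit Arguments.
Unset Strict Implicit.
Unset Printing Implicit Defensive.

Import Order.TTheory GRing.Theory Num.Theory.
Import numFieldNormedType.Exports.

Local Open Scope ring_scope.
Local Open Scope classical_set_scope.

Definition facility := 'I_2.
Definition facility1 : facility := ord0.
Definition facility2 : facility := ord_max.

(* A profile of approval preferences: [t i j] iff agent [i] approves
   facility [j]. *)
Definition preferences (N : finType) := N -> facility -> bool.

(* [{i01 R}] is the type of the elements of [R] in the interval [0, 1]. *)
Record instance (R : realType) (N : finType) := Instance {
  position : N -> {i01 R} ;
  approves : preferences N ;
  approves_some : forall i, [exists j, approves i j] }.

Definition outcome (R : realType) := (facility * {i01 R})%type.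

Definition mechanism (R : realType) (N : finType) := instance R N -> outcome R.

Fact half_ge0 (R : realType) : 0 <= 2^-1 :> R.
Proof. by rewrite invr_ge0 ler0n. Qed.

Fact half_le1 (R : realType) : 2^-1 <= 1 :> R.
Proof. by rewrite invf_le1 ?ltr0n// ler1n. Qed.

Definition midpoint (R : realType) : {i01 R} :=
  Itv01 (half_ge0 R) (half_le1 R).

Section Model.
Context {R : realType} {N : finType}.
Implicit Types (I : instance R N) (o : outcome R) (M : mechanism R N).

Definition utility I (i : N) o : R :=
  (approves I i o.1)%:R * (1 - `|(position I i)%:num - o.2%:num|).

Definition welfare I o : R := \sum_(i : N) utility I i o.

(* The supremum is a maximum: see [opt_welfare_max] below. *)
Definition opt_welfare I : R := sup (range (welfare I)).

(* The quotient is that of [\bar R], where [0^-1 = +oo], so a mechanism whose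
   welfare vanishes on an instance of positive optimum has an infinite
   ratio. *)
Definition approximation_ratio M : \bar R :=
  ereal_sup [set ((opt_welfare I)%:E / (welfare I (M I))%:E)%E | I in setT].

(* [I] is the true instance and [I'] the reported one; the agents outside the
   coalition [C] report their positions and preferences truthfully. *)
Definition coalition_misreport (C : {set N}) I I' : Prop :=
  forall i, i \notin C ->
    position I' i = position I i /\ approves I' i = approves I i.

Definition group_strategyproof M : Prop :=
  ~ exists (I I' : instance R N) (C : {set N}),
      [/\ C != finset.set0, coalition_misreport C I I' &
          forall i, i \in C -> utility I i (M I) < utility I i (M I')].

Definition num_approvals (t : preferences N) (j : facility) : nat :=
  #|[pred i | t i j]|.

(* The tie-breaking rule [tie] is arbitrary, except that it cannot depend on
   the positions, which the mechanism ignores. *)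
Definition most_preferred (tie : preferences N -> facility)
    (t : preferences N) : facility :=
  if (num_approvals t facility2 < num_approvals t facility1)%N then facility1
  else if (num_approvals t facility1 < num_approvals t facility2)%N
  then facility2
  else tie t.

Definition middle (tie : preferences N -> facility) : mechanism R N :=
  fun I => (most_preferred tie (approves I), midpoint R).

Lemma opt_welfare_max I :
  exists2 o, welfare I o = opt_welfare I &
             forall o', welfare I o' <= opt_welfare I.
Proof.
pose f j (y : R) : R :=
  \sum_(i : N) (approves I i j)%:R * (1 - `|(position I i)%:num - y|).
have cf j : continuous (f j).
  move=> y; apply: (cvg_big (op := +%R)) => [|i _]; first exact: add_continuous.
  apply: cvgM; first exact: cvg_cst.
  apply: cvgB; first exact: cvg_cst.
  by apply: cvg_norm; apply: cvgB; [exact: cvg_cst|exact: cvg_id].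
have best j : exists y : {i01 R}, forall y' : {i01 R},
    welfare I (j, y') <= welfare I (j, y).
  have [] := @EVT_max R (f j) 0 1 ler01.
    exact: continuous_subspaceT.
  move=> c; rewrite in_itv/= => /andP[c0 c1] cmax.
  exists (Itv01 c0 c1) => y; apply: cmax.
  by rewrite in_itv/= ge0 le1.
have [y1 y1P] := best facility1.
have [y2 y2P] := best facility2.
have [z zP] : exists z, forall z', welfare I z' <= welfare I z.
  have jP (j : facility) : j = facility1 \/ j = facility2.
    by case: j => [[|[|//]] ?]; [left|right]; apply: val_inj.
  have [w12|/ltW w21] := leP (welfare I (facility1, y1))
                             (welfare I (facility2, y2)).
    exists (facility2, y2) => -[j y]; have [->|->//] := jP j.
    exact: le_trans w12.
  exists (facility1, y1) => -[j y]; have [->//|->] := jP j.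
  exact: le_trans w21.
have optE : opt_welfare I = welfare I z.
  apply/eqP; rewrite eq_le; apply/andP; split.
    apply: ge_sup; first by exists (welfare I z), z.
    by move=> _ [z' _ <-].
  apply: ub_le_sup; last by exists z.
  by exists (welfare I z) => _ [z' _ <-].
by exists z => [|z']; rewrite optE.
Qed.

End Model.

(* Main.v *)
(** Only agents who approve the other facility alone can gain from a change of
    outcome, and they cannot raise its count or lower that of the chosen one.
    So the outcome can only change if both counts are unchanged (and tied); but
    then no preference report has changed, and the tie is broken as before.
    For the ratio, an agent gets at most 1 from a facility she approves, and at
    least 1/2 when it is at the midpoint. *)
Require Import Defs.
From mathcomp Require Import all_boot all_order all_algebra.
From mathcomp Require Import all_classical all_reals all_analysis.
From mathcomp Require Import lra.

Import Order.TTheory GRing.Theory Num.Theory.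

Local Open Scope ring_scope.

Lemma facilityP (j : facility) : j = facility1 \/ j = facility2.
Proof. by case: j => [[|[|//]] ?]; [left|right]; apply: val_inj. Qed.

Section MostPreferred.
Context {N : finType} (tie : preferences N -> facility).
Implicit Types (t : preferences N) (j : facility).

Lemma most_preferred_max t j :
  (num_approvals t j <= num_approvals t (most_preferred tie t))%N.
Proof.
rewrite /most_preferred.
by case: (ltngtP (num_approvals t facility2) (num_approvals t facility1))
  => [lt21|lt12|eq12]; have [->|->] := facilityP j;
  rewrite // ?(ltnW lt21) ?(ltnW lt12)//;
  have [->|->] := facilityP (tie t); rewrite // eq12.
Qed.

Lemma num_approvals_le {t t' j} :
  (forall i, t i j -> t' i j) -> (num_approvals t j <= num_approvals t' j)%N.
Proof.
by move=> tt'; apply/subset_leq_card/fintype.subsetP => i; exact: tt'.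
Qed.

(** A finite set included in another of no larger cardinality is equal to it. *)
Lemma num_approvals_inj {t t' j} :
  (forall i, t i j -> t' i j) ->
  (num_approvals t' j <= num_approvals t j)%N -> forall i, t i j = t' i j.
Proof.
move=> tt' le_t't i.
have sub : [pred i | t i j] \subset [pred i | t' i j].
  by apply/fintype.subsetP => k; exact: tt'.
by have /(_ i) := subset_cardP (anti_leq (introT andP
  (conj (subset_leq_card sub) le_t't))) sub.
Qed.

(** With [j] and [j'] the two winners, the hypotheses and maximality close a cycle: the count of [j]
    in [t] is at most that of [j] in [t'], then of [j'] in [t'], of [j'] in [t], and again of [j] in
    [t]. So all four are equal. *)
Lemma most_preferred_stable t t' :
  (forall i, t i (most_preferred tie t) -> t' i (most_preferred tie t)) ->
  (forall i, t' i (most_preferred tie t') -> t i (most_preferred tie t')) ->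
  most_preferred tie t = most_preferred tie t'.
Proof.
set j := most_preferred tie t; set j' := most_preferred tie t' => tt' t't.
have [//|jj'] := eqVneq j j'.
have le_j := num_approvals_le tt'; have le_j' := num_approvals_le t't.
have max_t := most_preferred_max t j'.
have max_t' := most_preferred_max t' j.
(* Equal counts would not suffice: [tie] may depend on the whole profile. *)
suff t_eq : t = t' by rewrite /j /j' t_eq.
have eq_j : forall i, t i j = t' i j.
  apply: num_approvals_inj tt' _.
  exact: leq_trans max_t' (leq_trans le_j' max_t).
have eq_j' : forall i, t' i j' = t i j'.
  apply: num_approvals_inj t't _.
  exact: leq_trans max_t (leq_trans le_j max_t').
apply/funext => i; apply/funext => k.
(* With only two facilities, the distinct [j] and [j'] are all of them. *)
have [->|->] : k = j \/ k = j'; rewrite ?eq_j ?eq_j'//.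
by move: jj'; have [->|->] := facilityP j; have [->|->] := facilityP j';
  have [->|->] := facilityP k; rewrite ?eqxx//; tauto.
Qed.

End MostPreferred.

Section Welfare.
Context {R : realType} {N : finType}.
Implicit Types (I : instance R N) (o : outcome R) (j : facility).

Lemma dist_midpoint_le (x : {i01 R}) :
  `|x%:num - (midpoint R)%:num| <= 2^-1 :> R.
Proof.
have x0 : 0 <= x%:num :> R by [].
have x1 : x%:num <= 1 :> R by [].
by rewrite ler_norml /=; lra.
Qed.

Lemma utility_midpoint_ge I i j :
  (approves I i j)%:R / 2 <= utility I i (j, midpoint R).
Proof.
rewrite ler_wpM2l ?ler0n//=.
by have := dist_midpoint_le (position I i); lra.
Qed.

Lemma utility_le I i o : utility I i o <= (approves I i o.1)%:R.
Proof. by rewrite ler_piMr ?ler0n// lerBlDr lerDl. Qed.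

(** Both outcomes share the same distance factor, which is at least 1/2, so only the approvals can
    make the difference. *)
Lemma utility_midpoint_lt {I i j j'} :
  utility I i (j, midpoint R) < utility I i (j', midpoint R) ->
  ~~ approves I i j /\ approves I i j'.
Proof.
have := dist_midpoint_le (position I i).
by rewrite /utility /=; case: (approves I i j); case: (approves I i j') => //=;
  rewrite ?mul0r ?mul1r ?ltxx//; lra.
Qed.

Lemma num_approvals_sum I j :
  (num_approvals (approves I) j)%:R = \sum_i (approves I i j)%:R :> R.
Proof.
rewrite /num_approvals -sum1_card natr_sum [LHS]big_mkcond.
by apply: eq_bigr => i _; rewrite inE; case: approves.
Qed.

Lemma welfare_le I o : welfare I o <= (num_approvals (approves I) o.1)%:R.
Proof.
by rewrite num_approvals_sum; apply: ler_sum => i _; exact: utility_le.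
Qed.

Lemma welfare_midpoint_ge I j :
  (num_approvals (approves I) j)%:R / 2 <= welfare I (j, midpoint R).
Proof.
rewrite num_approvals_sum mulr_suml.
by apply: ler_sum => i _; exact: utility_midpoint_ge.
Qed.

Lemma middle_group_strategyproof (tie : preferences N -> facility) :
  group_strategyproof (middle (R := R) tie).
Proof.
move=> [I [I' [C [C0 truthful gain]]]].
have gainC i (iC : i \in C) := utility_midpoint_lt (gain i iC).
have stable :
    most_preferred tie (approves I) = most_preferred tie (approves I').
  (* By [gainC], a coalition member truly approves the new winner and not the old one, whatever the
     report; the others report truthfully. *)
  apply: most_preferred_stable => i;
    have [/gainC[/negP]//|/truthful[_ ->]//] := boolP (i \in C).
case/finset.set0Pn: C0 => i /gain.
by rewrite /middle stable ltxx.
Qed.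

(** The optimum is at most the count of its own facility, hence at most the largest count, half of
    which is guaranteed at the midpoint. *)
Lemma opt_welfare_middle_le (tie : preferences N -> facility) I :
  opt_welfare I <= 2 * welfare I (middle tie I).
Proof.
have [best <- _] := opt_welfare_max I.
rewrite mulrC -ler_pdivrMr ?ltr0n//; apply: le_trans (welfare_midpoint_ge _ _).
rewrite ler_pM2r ?invr_gt0 ?ltr0n//; apply: le_trans (welfare_le _ _) _.
by rewrite ler_nat most_preferred_max.
Qed.

Lemma welfare_middle_gt0 (tie : preferences N -> facility) I :
  (0 < #|N|)%N -> 0 < welfare I (middle tie I).
Proof.
move=> /card_gt0P[i _]; apply: lt_le_trans (welfare_midpoint_ge _ _).
rewrite divr_gt0 ?ltr0n//.
have /existsP[j tij] := approves_some I i.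
apply: leq_trans (most_preferred_max _ _ j).
by apply/card_gt0P; exists i.
Qed.

End Welfare.

Theorem theorem3p1 (R : realType) (N : finType) (N_gt0 : (0 < #|N|)%N)
    (tie : preferences N -> facility) :
  group_strategyproof (middle (R := R) tie) /\
  (approximation_ratio (middle (R := R) tie) <= 2%:E)%E.
Proof.
split; first exact: middle_group_strategyproof.
apply: ge_ereal_sup => _ [I _ <-].
have W_gt0 := welfare_middle_gt0 tie I N_gt0.
(* Positive welfare rules out the case [0^-1 = +oo], leaving a quotient of reals. *)
rewrite inver (gt_eqF W_gt0) -EFinM lee_fin ler_pdivrMr//.
exact: opt_welfare_middle_le.
Qed.
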